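(* Let $d\ge 1$ and $k\ge1$ be integers. Then $$\left|\frac{\mathrm{Flt}(d,k)}{k^{1/d}}-\mathrm{Flt}(d,\infty)\right|\le\frac{\mathrm{Flt}(d,0)}{k^{1/d}}.$$ In particular, $\lim_{k\to\infty}k^{-1/d}\,\mathrm{Flt}(d,k)=\mathrm{Flt}(d,\infty)$.
   Context: $\mathcal{K}^d$ is the set of convex bodies (non-empty compact convex sets) in $\mathbb{R}^d$. $\mathrm{G}^\circ(K)$ is the number of points of $\mathbb{Z}^d$ in the interior of $K$. The lattice width is $\mathrm{w}(K)=\inf_{u\in\mathbb{Z}^d\setminus\{0\}}\left(\max_{x\in K}\langle u,x\rangle-\min_{x\in K}\langle u,x\rangle\right)$. For $k\in\mathbb{Z}_{\ge0}$, $\mathrm{Flt}(d,k)=\sup\{\mathrm{w}(K):K\in\mathcal{K}^d,\ \mathrm{G}^\circ(K)\le k\}$. Further, $\mathrm{Flt}(d,\infty)=\sup\{\mathrm{w}(K):K\in\mathcal{K}^d,\ \mathrm{vol}(K)\le1\}$. *)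

(* Defs.v *)
From HB Require Import structures.
From mathcomp Require Import all_boot all_order all_algebra.
From mathcomp Require Import all_classical all_reals all_analysis.

Set Implicit Arguments.
Unset Strict Implicit.
Unset Printing Implicit Defensive.

Import Order.TTheory GRing.Theory Num.Theory.
Import numFieldNormedType.Exports.

Local Open Scope classical_set_scope.
Local Open Scope ring_scope.

(* Vectors of R^d are row vectors; their topology is that of the sup norm. *)

Definition dot (R : realType) (d : nat) (u x : 'rV[R]_d) : R :=
  \sum_(i < d) u 0 i * x 0 i.

Definition convex_body (R : realType) (d : nat) (K : set 'rV[R]_d) : Prop :=
  [/\ K !=set0, compact K & convex_set K].

Definition lattice (R : realType) (d : nat) : set 'rV[R]_d :=
  range (map_mx intr : 'rV[int]_d -> 'rV[R]_d).

(* [counting] takes the value +oo on infinite sets. *)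
Definition interior_lattice_points (R : realType) (d : nat)
    (K : set 'rV[R]_d) : \bar R :=
  counting (K° `&` @lattice R d).

(* For a convex body [K] the supremum and the infimum are attained (they are
   the maximum and the minimum), by compactness. *)
Definition directional_width (R : realType) (d : nat) (u : 'rV[R]_d)
    (K : set 'rV[R]_d) : R :=
  sup [set dot u x | x in K] - inf [set dot u x | x in K].

Definition lattice_width (R : realType) (d : nat) (K : set 'rV[R]_d) : R :=
  inf [set directional_width (map_mx intr u) K
      | u in [set u : 'rV[int]_d | u != 0]].

Definition box (R : realType) (d : nat) (a b : 'rV[R]_d) : set 'rV[R]_d :=
  [set x | forall i, a 0 i <= x 0 i <= b 0 i].

Definition box_volume (R : realType) (d : nat) (a b : 'rV[R]_d) : R :=
  \prod_(i < d) (b 0 i - a 0 i).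

(* d-dimensional Lebesgue (outer) measure: the infimum of the total volume of
   countable covers by boxes. Convex bodies are compact, hence measurable, so
   the outer measure of a convex body is its volume. *)
Definition volume (R : realType) (d : nat) (A : set 'rV[R]_d) : \bar R :=
  ereal_inf [set (\sum_(0 <= n <oo) (box_volume (ab n).1 (ab n).2)%:E)%E
            | ab in [set ab : nat -> 'rV[R]_d * 'rV[R]_d |
                (forall n i, (ab n).1 0 i <= (ab n).2 0 i) /\
                A `<=` \bigcup_n box (ab n).1 (ab n).2]].

(* The suprema defining Flt are taken in the extended reals, so that they make
   sense without first knowing that they are finite. *)
Definition Flt (R : realType) (d k : nat) : \bar R :=
  ereal_sup [set (lattice_width K)%:E
            | K in [set K : set 'rV[R]_d |
                convex_body K /\
                (interior_lattice_points K <= k%:R%:E)%E]].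

Definition Flt_infty (R : realType) (d : nat) : \bar R :=
  ereal_sup [set (lattice_width K)%:E
            | K in [set K : set 'rV[R]_d |
                convex_body K /\ (volume K <= 1%:E)%E]].

(* Main.v *)
Require Import Defs.
From mathcomp Require Import all_boot all_order all_algebra.
From mathcomp Require Import all_classical all_reals all_analysis.
From mathcomp Require Import ring lra.

Set Implicit Arguments.
Unset Strict Implicit.
Unset Printing Implicit Defensive.

Import Order.TTheory GRing.Theory Num.Theory.
Import numFieldNormedType.Exports.

Local Open Scope classical_set_scope.
Local Open Scope ring_scope.

(* Write w for the lattice width. A translate of a convex body of width larger
   than Flt(d,0) has an interior lattice point. If K has at most k interior
   lattice points and lam w(K) > Flt(d,0), all translates of lam K therefore meet
   Z^d, so that (1 - lam) K can be cut into pieces of a fundamental domain indexed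
   by lattice points of (1 - lam) K + lam K° `<=` K°; hence (1 - lam) K has volume
   at most k, and Flt(d,k) <= Flt(d,0) + k^(1/d) Flt(d,oo). Conversely, by
   averaging over a fine grid, a body of volume less than k + 1 has a translate
   with at most k lattice points, so that k^(1/d) Flt(d,oo) <= Flt(d,k).

   The theorem also needs the flatness theorem Flt(d,0) < oo, proved by induction
   on d. If the first coordinate nearly attains the lattice width (which a
   unimodular transformation achieves), then a slice at an integer height t in the
   middle of K is wide: a functional v that is short on the slice becomes short on
   K after adding a real multiple of the first coordinate, and rounding the
   multiple costs at most about half the width of K. *)

(** * The flatness theorem *)

Section Dot.
Context {R : realType} {d : nat}.
Implicit Types (u v x y : 'rV[R]_d) (a : R).

Lemma dotC u x : dot u x = dot x u.
Proof. by apply: eq_bigr => i _; rewrite mulrC. Qed.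

Lemma dotDr u x y : dot u (x + y) = dot u x + dot u y.
Proof. by rewrite -big_split; apply: eq_bigr => i _; rewrite mxE mulrDr. Qed.

Lemma dotZr u a x : dot u (a *: x) = a * dot u x.
Proof. by rewrite /dot mulr_sumr; apply: eq_bigr => i _; rewrite mxE mulrCA. Qed.

Lemma dotDl u v x : dot (u + v) x = dot u x + dot v x.
Proof. by rewrite dotC dotDr !(dotC x). Qed.

Lemma dotZl a u x : dot (a *: u) x = a * dot u x.
Proof. by rewrite dotC dotZr dotC. Qed.

Lemma dot_mulmx e (v : 'rV[R]_e) (A : 'M[R]_(e, d)) x :
  dot v (x *m A^T) = dot (v *m A) x.
Proof.
have dotE n (w z : 'rV[R]_n) : dot w z = (w *m z^T) 0 0.
  by rewrite mxE; apply: eq_bigr => i _; rewrite mxE.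
by rewrite !dotE trmx_mul trmxK mulmxA.
Qed.

End Dot.

Lemma dot_row_mx (R : realType) (d : nat) (a b : 'rV[R]_1) (u x : 'rV[R]_d) :
  dot (row_mx a u) (row_mx b x) = a 0 0 * b 0 0 + dot u x.
Proof.
rewrite /dot big_split_ord big_ord1 !row_mxEl; congr (_ + _).
by apply: eq_bigr => i _; rewrite !row_mxEr.
Qed.

Lemma convex_comb (R : realType) (d : nat) (K : set 'rV[R]_d) x y (t : R) :
  convex_set K -> K x -> K y -> 0 <= t <= 1 -> K (t *: x + (1 - t) *: y).
Proof.
move=> cK Kx Ky t01.
have /set_mem := cK x y (Itv01 (proj1 (andP t01)) (proj2 (andP t01)))
  (mem_set Kx) (mem_set Ky).
by [].
Qed.

Lemma convex_combP (R : realType) (d : nat) (K : set 'rV[R]_d) :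
  (forall x y (t : R), K x -> K y -> 0 <= t <= 1 ->
     K (t *: x + (1 - t) *: y)) -> convex_set K.
Proof.
move=> cK x y t /set_mem Kx /set_mem Ky; apply/mem_set/cK => //.
by apply/andP; split.
Qed.

(** Closed balls of the sup norm. Interior points are expressed through them, so that only
    coordinatewise inequalities have to be checked. *)
Definition cube (R : realType) (d : nat) (x : 'rV[R]_d) (r : R) : set 'rV[R]_d :=
  [set y | forall i, `|y 0 i - x 0 i| <= r].

Lemma entries_bounded (R : realType) (m n : nat) (A : 'M[R]_(m, n)) :
  exists2 B, 0 < B & forall i j, `|A i j| <= B.
Proof.
exists (1 + \sum_i \sum_j `|A i j|) => [|i j].
  by rewrite ltr_pwDl// sumr_ge0// => i _; rewrite sumr_ge0.
rewrite (bigD1 i)//= (bigD1 j)//=.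
have ? : 0 <= \sum_(k | k != j) `|A i k| by rewrite sumr_ge0.
have ? : 0 <= \sum_(k | k != i) \sum_l `|A k l|.
  by rewrite sumr_ge0// => k _; rewrite sumr_ge0.
lra.
Qed.

(* After subtracting a multiple of u, the functional v is constant on the chord
   from x0 to x1; a point y of K can then deviate from this constant by at most
   5 l, because the segment from y to x0 or to x1 crosses the slice u = t after
   at least one fifth of its length. *)
Lemma width_slice (R : realType) (n : nat) (K : set 'rV[R]_n) (u v x0 x1 : 'rV[R]_n)
    (s t l : R) : convex_set K -> 0 < s -> K x0 -> K x1 ->
  dot u x0 + s / 4%:R <= t -> t <= dot u x1 - s / 4%:R ->
  (forall x y, K x -> K y -> dot u x - dot u y <= 5%:R / 4%:R * s) ->
  (forall x y, K x -> K y -> dot u x = t -> dot u y = t ->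
     dot v x - dot v y <= l) ->
  exists a, forall x y, K x -> K y ->
    dot v x - dot v y + a * (dot u x - dot u y) <= 10%:R * l.
Proof.
move=> cK s0 Kx0 Kx1 t0 t1 Ku Kv.
pose D := dot u x1 - dot u x0.
have D0 : 0 < D by rewrite /D; lra.
pose a := - (dot v x1 - dot v x0) / D.
pose F x := dot v x + a * dot u x.
have F01 : F x1 = F x0.
  have aD : a * D = - (dot v x1 - dot v x0) by rewrite /a divfK ?gt_eqF.
  have : F x1 - F x0 = (dot v x1 - dot v x0) + a * D by rewrite /F /D; ring.
  by rewrite aD subrr => /eqP; rewrite subr_eq0 => /eqP.
have FC b x y : F (b *: x + (1 - b) *: y) = b * F x + (1 - b) * F y.
  by rewrite /F !(dotDr, dotZr); ring.
(* Here [z] is a chord endpoint, at [u]-distance at least s/4 from the slice, and [y] lies on the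
   other side. The [u]-width is at most 5s/4, so the crossing parameter [b] is at least (s/4)/(5s/4)
   = 1/5. *)
have hit (z y : 'rV[R]_n) : K z -> K y -> F z = F x0 ->
    (s / 4%:R <= t - dot u z /\ t <= dot u y) \/
    (s / 4%:R <= dot u z - t /\ dot u y <= t) ->
    exists2 b, 1 / 5%:R <= b <= 1 &
      let q := b *: y + (1 - b) *: z in
      [/\ K q, dot u q = t & F q - F x0 = b * (F y - F x0)].
  move=> Kz Ky Fz tzy.
  have yz0 : dot u y - dot u z != 0.
    by apply/eqP; case: tzy => -[? ?] ?; lra.
  pose b := (t - dot u z) / (dot u y - dot u z).
  have bE : b * (dot u y - dot u z) = t - dot u z by rewrite /b divfK.
  have b01 : 1 / 5%:R <= b <= 1.
    have h1 := Ku _ _ Ky Kz; have h2 := Ku _ _ Kz Ky.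
    case: tzy => -[h3 h4].
      have h : 0 < dot u y - dot u z by lra.
      by rewrite /b ler_pdivlMr// ler_pdivrMr//; apply/andP; split; lra.
    have h : dot u y - dot u z < 0 by lra.
    by rewrite /b ler_ndivlMr// ler_ndivrMr//; apply/andP; split; lra.
  exists b => //; split.
  - by apply: convex_comb => //; lra.
  - by rewrite dotDr !dotZr; lra.
  - by rewrite FC Fz; ring.
have [p [Kp up Fp]] : exists p, [/\ K p, dot u p = t & F p = F x0].
  have [|b b01 [Kq uq Fq]] := hit _ _ Kx0 Kx1 erefl; first by left; split; lra.
  by exists (b *: x1 + (1 - b) *: x0); split=> //; move: Fq; rewrite F01; lra.
have Fbound y : K y -> `|F y - F x0| <= 5%:R * l.
  move=> Ky.
  have [b b01 [q [Kq uq Fq]]] : exists2 b, 1 / 5%:R <= b <= 1 &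
      exists q, [/\ K q, dot u q = t & F q - F x0 = b * (F y - F x0)].
    (* The segment starts at the chord endpoint across the slice from [y]. *)
    case: (lerP t (dot u y)) => yt.
      have [|b ? hq] := hit _ _ Kx0 Ky erefl;
        last by exists b => //; exists (b *: y + (1 - b) *: x0).
      by left; split; lra.
    have [|b ? hq] := hit _ _ Kx1 Ky F01;
      last by exists b => //; exists (b *: y + (1 - b) *: x1).
    by right; split; lra.
  have h1 := Kv _ _ Kq Kp uq up; have h2 := Kv _ _ Kp Kq up uq.
  have e1 : dot v q - dot v p = b * (F y - F x0).
    by rewrite -Fq -Fp /F uq up; ring.
  rewrite ler_norml; have [hF|hF] := lerP 0 (F y - F x0); apply/andP; split; nra.
exists a => x y Kx Ky.
have := Fbound _ Kx; have := Fbound _ Ky; rewrite !ler_norml /F => *; lra.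
Qed.

(** A point [y] close to (t,z) lies on a segment from [x0] or [x1], whichever is on its side of the
    hyperplane, to a point (t,x') of the slice. The weight [b] of the endpoint is small, so x' stays
    in the cube around [z]. *)
Lemma cube_of_slice (R : realType) (d : nat) (K : set 'rV[R]_(1 + d))
    (x0 x1 : 'rV[R]_(1 + d)) (t r : R) (z : 'rV[R]_d) :
  convex_set K -> K x0 -> K x1 -> x0 0 0 < t -> t < x1 0 0 -> 0 < r ->
  cube z r `<=` [set y | K (row_mx t%:M y)] ->
  exists2 r', 0 < r' & cube (row_mx t%:M z) r' `<=` K.
Proof.
move=> cK Kx0 Kx1 t0 t1 r0 zrK.
pose a := Num.min (t - x0 0 0) (x1 0 0 - t).
have a0 : 0 < a by rewrite lt_min; apply/andP; split; lra.
have [B0 B0p hB0] := entries_bounded (z - rsubmx x0).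
have [B1 B1p hB1] := entries_bounded (z - rsubmx x1).
pose B := B0 + B1.
have Bp : 0 < B by rewrite addr_gt0.
(* The first bound keeps the weight [b] below 1/2; the second gives 2(r' + r'B/a) <= r, which keeps
   x' within distance [r] of [z]. *)
pose r' := Num.min (a / 2%:R) (r * a / (2%:R * (a + B))).
have r'0 : 0 < r'.
  by rewrite lt_min divr_gt0//= divr_gt0// ?mulr_gt0// addr_gt0.
have r'a : r' <= a / 2%:R by rewrite ge_min lexx.
have r'r : 2%:R * (r' + r' / a * B) <= r.
  have : r' <= r * a / (2%:R * (a + B)) by rewrite ge_min lexx orbT.
  rewrite ler_pdivlMr ?mulr_gt0// ?addr_gt0// => h.
  have : 2%:R * (r' + r' / a * B) * a <= r * a.
    have -> : 2%:R * (r' + r' / a * B) * a = r' * (2%:R * (a + B)).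
      by field; rewrite gt_eqF.
    by [].
  by rewrite ler_pM2r.
exists r' => // y hy.
have aux (w : 'rV[R]_(1 + d)) : K w -> (forall i, `|z 0 i - w 0 (rshift 1 i)| <= B) ->
    a <= `|w 0 0 - t| -> 0 <= (y 0 0 - t) * (w 0 0 - t) -> K y.
  move=> Kw hw aw yw.
  have wt0 : w 0 0 - t != 0 by rewrite -normr_gt0; lra.
  pose b := (y 0 0 - t) / (w 0 0 - t).
  have bE : b * (w 0 0 - t) = y 0 0 - t by rewrite /b divfK.
  have yt : `|y 0 0 - t| <= r'.
    have := hy 0; rewrite (_ : 0 = lshift d 0 :> 'I_(1 + d)); last exact: val_inj.
    by rewrite row_mxEl mxE eqxx mulr1n.
  have b0 : 0 <= b.
    have wt2 : 0 < (w 0 0 - t) ^+ 2 by rewrite exprn_even_gt0.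
    by rewrite -(pmulr_lge0 _ wt2) expr2 mulrA bE.
  have br : b * a <= r'.
    apply: le_trans yt; rewrite -bE normrM (ger0_norm b0).
    exact: ler_wpM2l.
  have b2 : b <= 1 / 2%:R by rewrite -(ler_pM2r a0); lra.
  (* Solution of y = b w + (1 - b)(t, x'). *)
  pose x' := (1 - b)^-1 *: (rsubmx y - b *: rsubmx w).
  have b1 : 1 - b != 0 by rewrite gt_eqF; lra.
  have Kx' : K (row_mx t%:M x').
    apply: zrK => i; rewrite !mxE.
    have -> : (1 - b)^-1 * (y 0 (rshift 1 i) - b * w 0 (rshift 1 i)) - z 0 i =
        (1 - b)^-1 * ((y 0 (rshift 1 i) - z 0 i) + b * (z 0 i - w 0 (rshift 1 i))).
      by field.
    rewrite normrM gtr0_norm ?invr_gt0; last by lra.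
    rewrite ler_pdivrMl; last by lra.
    apply: le_trans (ler_normD _ _) _; rewrite normrM (ger0_norm b0).
    have h1 : `|y 0 (rshift 1 i) - z 0 i| <= r'.
      by have := hy (rshift 1 i); rewrite row_mxEr.
    have h2 : b * `|z 0 i - w 0 (rshift 1 i)| <= r' / a * B.
      apply: ler_pM => //; first by rewrite ler_pdivlMr.
    have h3 : (r' + r' / a * B) <= (1 - b) * r by nra.
    lra.
  have -> : y = b *: w + (1 - b) *: row_mx t%:M x'.
    apply/rowP => i; rewrite !mxE; case: splitP => j ij.
      have -> : i = 0 by apply: val_inj; rewrite /= ij (ord1 j).
      by rewrite mxE (ord1 j) eqxx mulr1n; lra.
    have -> : i = rshift 1 j by apply: val_inj.
    by rewrite !mxE; field.
  by apply: convex_comb => //; lra.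
have [yt|yt] := lerP t (y 0 0).
- apply: (aux x1) => //.
  + by move=> i; have := hB1 0 i; rewrite !mxE /B; lra.
  + by rewrite ger0_norm ?ge_min ?lexx ?orbT//; lra.
  + by apply: mulr_ge0; lra.
- apply: (aux x0) => //.
  + by move=> i; have := hB0 0 i; rewrite !mxE /B; lra.
  + by rewrite ltr0_norm ?opprB ?ge_min ?lexx//; lra.
  + by apply: mulr_le0; lra.
Qed.

(** The flatness theorem with constant [c]. Boundedness in every direction stands in for compactness
    and widths are witnessed by pairs of points, so that slices and linear images inherit the
    hypotheses without any topology. *)
Definition flat_bound (R : realType) (d : nat) (c : R) := forall K : set 'rV[R]_d,
  K !=set0 -> convex_set K ->
  (forall u, exists b : R, forall x y, K x -> K y -> dot u x - dot u y <= b) ->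
  (forall u : 'rV[int]_d, u != 0 -> exists x y, [/\ K x, K y &
     c <= dot (map_mx intr u) x - dot (map_mx intr u) y]) ->
  exists z : 'rV[int]_d, exists2 r, 0 < r & cube (map_mx intr z) r `<=` K.

Lemma dot_coord0 (R : realType) (d : nat) (x : 'rV[R]_(1 + d)) :
  dot (row_mx 1%:M 0) x = x 0 0.
Proof.
rewrite -[in LHS](hsubmxK x) dot_row_mx !mxE eqxx mul1r.
rewrite (_ : lshift d 0 = 0); last exact: val_inj.
by rewrite /dot big1 ?addr0// => i _; rewrite !mxE mul0r.
Qed.

(** Here [s] is approximately the lattice width. If an integer [v] varied by at most [c] on the
    slice, [width_slice] would give a real [a] such that v + a x_0 varies by at most 10c <= s/10 on
    K. Rounding [a] costs at most (1/2)(5s/4), and s/10 + 5s/8 < 3s/4 is a contradiction. *)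
Lemma flat_bound_slice (R : realType) (d : nat) (c s : R) (K : set 'rV[R]_(1 + d))
    (x0 x1 : 'rV[R]_(1 + d)) :
  flat_bound d c -> 1 <= c -> 100%:R * c <= s -> convex_set K ->
  (forall u, exists b : R, forall x y, K x -> K y -> dot u x - dot u y <= b) ->
  K x0 -> K x1 -> 3%:R / 4%:R * s <= x1 0 0 - x0 0 0 ->
  (forall x y, K x -> K y -> x 0 0 - y 0 0 <= 5%:R / 4%:R * s) ->
  (forall u : 'rV[int]_(1 + d), u != 0 -> exists x y, [/\ K x, K y &
     3%:R / 4%:R * s <= dot (map_mx intr u) x - dot (map_mx intr u) y]) ->
  exists z : 'rV[int]_(1 + d), exists2 r, 0 < r &
    cube (map_mx intr z) r `<=` K.
Proof.
move=> IH c1 sc cK bK Kx0 Kx1 x01 K0 Ku.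
(* The admissible heights, at distance s/4 from both ends, form an interval of length at least s/4
   >= 25, so it contains this integer. *)
pose ti := Num.floor (x1 0 0 - s / 4%:R); pose t : R := ti%:~R.
have t1 : t <= x1 0 0 - s / 4%:R by exact: floor_le_tmp.
have t0 : x0 0 0 + s / 4%:R <= t.
  have : x1 0 0 - s / 4%:R < t + 1 by rewrite -[1]/1%:~R -intrD floorD1_gt.
  lra.
pose S : set 'rV[R]_d := [set y | K (row_mx t%:M y)].
have dot0 (v : 'rV[R]_d) y : dot (row_mx 0 v) (row_mx t%:M y) = dot v y.
  by rewrite dot_row_mx mxE mul0r add0r.
have S0 : S !=set0.
  pose b := (t - x0 0 0) / (x1 0 0 - x0 0 0).
  have b01 : 0 <= b <= 1.
    by rewrite /b ler_pdivlMr ?ler_pdivrMr; lra.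
  exists (rsubmx (b *: x1 + (1 - b) *: x0)); rewrite /S /=.
  have <- : lsubmx (b *: x1 + (1 - b) *: x0) = t%:M.
    apply/rowP => i; rewrite !mxE (ord1 i) (_ : lshift d 0 = 0); last exact: val_inj.
    rewrite eqxx mulr1n /b; field; lra.
  by rewrite hsubmxK; exact: convex_comb.
have cS : convex_set S.
  apply: convex_combP => y z b Sy Sz b01; rewrite /S /=.
  have -> : row_mx t%:M (b *: y + (1 - b) *: z) =
      b *: row_mx t%:M y + (1 - b) *: row_mx t%:M z.
    rewrite !scale_row_mx add_row_mx; congr row_mx.
    by rewrite -scalerDl addrC subrK scale1r.
  exact: convex_comb.
have bS u : exists b : R, forall x y, S x -> S y -> dot u x - dot u y <= b.
  have [b hb] := bK (row_mx 0 u); exists b => x y Sx Sy.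
  by have := hb _ _ Sx Sy; rewrite !dot0.
have [|z [r r0 hr]] := IH S S0 cS bS.
  move=> v v0; apply: contrapT => vS.
  have vl x y : S x -> S y -> dot (map_mx intr v) x - dot (map_mx intr v) y <= c.
    move=> Sx Sy; apply/ltW; rewrite ltNge; apply/negP => h.
    by apply: vS; exists x, y.
  have [|||||a ha] := @width_slice _ _ K (row_mx 1%:M 0)
    (row_mx 0 (map_mx intr v)) x0 x1 s t c cK _ Kx0 Kx1.
  - by lra.
  - by rewrite dot_coord0.
  - by rewrite dot_coord0.
  - by move=> x y Kx Ky; rewrite !dot_coord0; exact: K0.
  - move=> x y Kx Ky; rewrite !dot_coord0 -(hsubmxK x) -(hsubmxK y).
    have E (w : 'rV[R]_(1 + d)) : row_mx (lsubmx w) (rsubmx w) 0 0 = t ->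
        lsubmx w = t%:M.
      move=> <-; rewrite hsubmxK; apply/rowP => i.
      rewrite !mxE (ord1 i) eqxx mulr1n; congr (w _ _); exact: val_inj.
    move=> /E hx /E hy; rewrite hx hy !dot0; apply: vl; rewrite /S /=.
      by rewrite -hx hsubmxK.
    by rewrite -hy hsubmxK.
  (* The integer nearest to [a]. The direction (n,v) is nonzero because [v] is. *)
  pose n := Num.floor (a + 1 / 2%:R).
  have n1 : (n%:~R : R) <= a + 1 / 2%:R by exact: floor_le_tmp.
  have n2 : a + 1 / 2%:R < (n%:~R : R) + 1.
    by rewrite -[1 in X in _ < X]/1%:~R -intrD floorD1_gt.
  have [|x [y [Kx Ky]]] := Ku (row_mx n%:M v).
    by apply: contraNneq v0 => h; rewrite -(row_mxKr n%:M v) h linear0.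
  have -> : map_mx intr (row_mx n%:M v) =
      row_mx 0 (map_mx intr v) + (n%:~R : R) *: row_mx 1%:M 0.
    rewrite map_row_mx scale_row_mx add_row_mx scaler0 addr0 add0r.
    by congr row_mx; rewrite map_scalar_mx scalemx1.
  rewrite !dotDl !dotZl !dot_coord0.
  have := ha x y Kx Ky; rewrite !dot_coord0.
  have := K0 x y Kx Ky; have := K0 y x Ky Kx.
  set X := x 0 0 - y 0 0; set V := dot _ x - dot _ y => h1 h2 h3 h4.
  have {}h4 : 3%:R / 4%:R * s <= V + n%:~R * X by rewrite /V /X; lra.
  have : (n%:~R - a) * X <= 1 / 2%:R * (5%:R / 4%:R * s).
    apply: le_trans (ler_norm _) _; rewrite normrM; apply: ler_pM => //.
      by rewrite ler_norml; apply/andP; split; lra.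
    by rewrite /X in h1 h2 *; rewrite ler_norml; apply/andP; split; lra.
  lra.
have [||r' r'0 hr'] := cube_of_slice cK Kx0 Kx1 _ _ r0 hr.
- by lra.
- by lra.
exists (row_mx ti%:M z); exists r' => //.
by rewrite map_row_mx map_scalar_mx.
Qed.

(** The Smith normal form of the row [u] gives u = a w, with [a] a nonzero integer and [w] the first
    row of a unimodular [P]. As |a| >= 1, [w] is at least as short on K as [u], and [P] turns [w]
    into the first coordinate. *)
Lemma flat_bound_unimodular (R : realType) (d : nat) (c s : R)
    (K : set 'rV[R]_(1 + d)) (u : 'rV[int]_(1 + d)) :
  flat_bound d c -> 1 <= c -> 100%:R * c <= s -> K !=set0 -> convex_set K ->
  (forall u, exists b : R, forall x y, K x -> K y -> dot u x - dot u y <= b) ->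
  u != 0 -> (forall x y, K x -> K y ->
    dot (map_mx intr u) x - dot (map_mx intr u) y <= 5%:R / 4%:R * s) ->
  (forall u : 'rV[int]_(1 + d), u != 0 -> exists x y, [/\ K x, K y &
     3%:R / 4%:R * s <= dot (map_mx intr u) x - dot (map_mx intr u) y]) ->
  exists z : 'rV[int]_(1 + d), exists2 r, 0 < r &
    cube (map_mx intr z) r `<=` K.
Proof.
move=> IH c1 sc K0 cK bK u0 Ku Kw.
have [L _ [P Pu [dd _ uE]]] := int_Smith_normal_form u.
pose a := L 0 0 * dd`_0; pose w := row 0 P.
have {}uE : u = a *: w.
  rewrite uE [L]mx11_scalar mul_scalar_mx -scalemxAl /a -scalerA /w rowE.
  congr (_ *: _); rewrite scalemxAl; congr (_ *m _).
  by apply/rowP => j; rewrite !mxE eqxx /= eq_sym mulr_natr.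
have a0 : a != 0 by apply: contraNneq u0 => h; rewrite uE h scale0r.
have w0 : w != 0 by apply: contraNneq u0 => h; rewrite uE h scaler0.
pose A : 'M[R]_(1 + d) := map_mx intr P.
pose B : 'M[R]_(1 + d) := map_mx intr (invmx P).
have AB : A *m B = 1%:M by rewrite -map_mxM mulmxV// map_mx1.
have BA : B *m A = 1%:M by rewrite -map_mxM mulVmx// map_mx1.
have ABK m (x : 'M[R]_(m, _)) : x *m A^T *m B^T = x.
  by rewrite -mulmxA -trmx_mul BA trmx1 mulmx1.
have BAK m (x : 'M[R]_(m, _)) : x *m B^T *m A^T = x.
  by rewrite -mulmxA -trmx_mul AB trmx1 mulmx1.
have wP (x : 'rV[R]_(1 + d)) : (x *m A^T) 0 0 = dot (map_mx intr w) x.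
  by rewrite mxE; apply: eq_bigr => j _; rewrite !mxE mulrC.
have Kw0 x y : K x -> K y ->
    dot (map_mx intr w) x - dot (map_mx intr w) y <= 5%:R / 4%:R * s.
  move=> Kx Ky; have := Ku _ _ Kx Ky; have := Ku _ _ Ky Kx.
  rewrite uE (_ : map_mx intr (a *: w) = (a%:~R : R) *: map_mx intr w);
    last by rewrite map_mxZ.
  rewrite !dotZl; set X := dot _ x; set Y := dot _ y => h1 h2.
  have : `|a%:~R * (X - Y)| <= 5%:R / 4%:R * s.
    by rewrite ler_norml; apply/andP; split; lra.
  apply: le_trans; apply: le_trans (ler_norm _) _.
  rewrite normrM ler_peMl// -intr_norm ler1z.
  by rewrite -gtz0_ge1 normr_gt0.
(* The image of K under x -> x A^T, written as a preimage under the inverse map. *)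
pose K' : set 'rV[R]_(1 + d) := [set x | K (x *m B^T)].
have K'A x : K x -> K' (x *m A^T) by rewrite /K' /= ABK.
have K'dot v x : dot v x = dot (v *m A) (x *m B^T) by rewrite -dot_mulmx BAK.
have [x1 [x0 [Kx1 Kx0 x01]]] := Kw w w0.
have [|||||z [r r0 hr]] := @flat_bound_slice _ d c s K' _ _ IH c1 sc _ _
    (K'A _ Kx0) (K'A _ Kx1).
- apply: convex_combP => x y b Kx Ky b01; rewrite /K' /=.
  by rewrite mulmxDl -!scalemxAl; exact: convex_comb.
- move=> v; have [b hb] := bK (v *m A); exists b => x y Kx Ky.
  by rewrite (K'dot _ x) (K'dot _ y); exact: hb.
- by rewrite !wP.
- move=> x y Kx Ky; rewrite -(BAK _ x) -(BAK _ y) !wP; exact: Kw0.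
- move=> v v0; have [|x [y [Kx Ky xy]]] := Kw (v *m P).
    by apply: contraNneq v0 => h; rewrite -[v](mulmxK Pu) h mul0mx.
  exists (x *m A^T), (y *m A^T); split; [exact: K'A|exact: K'A|].
  by rewrite !dot_mulmx -!map_mxM.
have [M M0 hM] := entries_bounded A.
(* This point is integral because [P] is invertible over the integers. Entries of [A] are at most
   [M] in absolute value, so x -> x A^T stretches the sup norm by at most M(1 + d). *)
exists (z *m (invmx P)^T); exists (r / (M * (1 + d)%:R)).
  by rewrite divr_gt0// mulr_gt0.
move=> y hy; rewrite -(ABK _ y); apply: hr => i.
have -> : map_mx intr z = map_mx intr (z *m (invmx P)^T) *m A^T :> 'rV[R]__.
  by rewrite map_mxM -map_trmx BAK.
set z' := map_mx intr _ in hy *.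
have -> : (y *m A^T) 0 i - (z' *m A^T) 0 i = ((y - z') *m A^T) 0 i.
  by rewrite mulmxBl !mxE.
rewrite mxE; apply: le_trans (ler_norm_sum _ _ _) _.
apply: (@le_trans _ _ (\sum_(j < 1 + d) (r / (M * (1 + d)%:R) * M))).
  apply: ler_sum => j _; rewrite normrM; apply: ler_pM => //.
    by have := hy j; rewrite !mxE.
  by rewrite mxE.
rewrite sumr_const card_ord -mulr_natr.
rewrite le_eqVlt; apply/orP; left; apply/eqP; field.
by rewrite (gt_eqF M0) andbT gt_eqF // ltr_pwDl.
Qed.

Lemma flatness (R : realType) (d : nat) : flat_bound d (100%:R ^+ d.+1 : R).
Proof.
elim: d => [|d IH] K [p Kp] cK bK Ku.
  by exists 0; exists 1 => // y _; rewrite thinmx0 -[X in K X](thinmx0 p).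
have c1 n : (1 : R) <= 100%:R ^+ n by rewrite exprn_ege1// ler1n.
(* The infimum [s] of [S] is the lattice width, written without suprema. A direction almost
   attaining it has width at most 5s/4, while 3s/4 < s bounds no direction. *)
pose S : set R := [set c | exists2 u : 'rV[int]_(1 + d), u != 0 &
  forall x y, K x -> K y -> dot (map_mx intr u) x - dot (map_mx intr u) y <= c].
have S0 : S !=set0.
  have [b hb] := bK (map_mx intr (const_mx 1 : 'rV[int]_(1 + d))).
  exists b; exists (const_mx 1) => //.
  by apply/eqP => /rowP /(_ 0); rewrite !mxE.
have SC : lbound S (100%:R ^+ d.+2).
  move=> c [u u0 hc]; have [x [y [Kx Ky xy]]] := Ku u u0.
  exact: le_trans xy (hc _ _ Kx Ky).
have sC := lb_le_inf S0 SC.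
set s := inf S in sC.
have s0 : 0 < s by apply: lt_le_trans sC; apply: lt_le_trans (c1 _).
have [||c [u u0 hu] hc] := @inf_adherent _ S (s / 4%:R).
- by rewrite divr_gt0.
- by split=> //; exists (100%:R ^+ d.+2).
apply: (@flat_bound_unimodular _ d (100%:R ^+ d.+1) s K u) => //.
- by exists p.
- move=> x y Kx Ky; apply: le_trans (hu _ _ Kx Ky) _.
  by rewrite -/s in hc; lra.
- move=> v v0; apply: contrapT => hv.
  have : s <= 3%:R / 4%:R * s; last by lra.
  apply: ge_inf; first by exists (100%:R ^+ d.+2).
  exists v => // x y Kx Ky; apply/ltW; rewrite ltNge; apply/negP => h.
  by apply: hv; exists x, y.
Qed.

(** * Widths of homothetic copies *)

Lemma dot_continuous (R : realType) (d : nat) (u : 'rV[R]_d) : continuous (dot u).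
Proof.
apply: (@continuous_big R _ (fun a b : R => a + b)) => [|i _ x].
  exact: pseudometric_normed_Zmodule.add_continuous.
by apply: continuousM; [exact: cst_continuous|exact: coord_continuous].
Qed.

Definition homothet (R : realType) (d : nat) (a : R) (p : 'rV[R]_d)
  (K : set 'rV[R]_d) : set 'rV[R]_d := [set a *: x + p | x in K].

Section Width.
Context {R : realType} {d : nat}.
Implicit Types (K : set 'rV[R]_d) (u x y p : 'rV[R]_d) (a : R).

Lemma directional_width_attained u K : convex_body K ->
  exists x y, [/\ K x, K y, directional_width u K = dot u x - dot u y &
    forall x' y', K x' -> K y' -> dot u x' - dot u y' <= directional_width u K].
Proof.
move=> [K0 cK _].
have cd : {within K, continuous (dot u)}.
  by apply: continuous_subspaceT => z; exact: dot_continuous.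
have [x xK hx] := compact_EVT_max K0 cK cd.
have [y yK hy] := compact_EVT_min K0 cK cd.
exists x, y; rewrite !inE in xK yK.
have -> : directional_width u K = dot u x - dot u y.
  congr (_ - _); apply/eqP; rewrite eq_le; apply/andP; split.
  - apply: ge_sup; first by exists (dot u x), x.
    by move=> _ [z Kz <-]; apply: hx; rewrite inE.
  - apply: ub_le_sup; last by exists x.
    by exists (dot u x) => _ [z Kz <-]; apply: hx; rewrite inE.
  - apply: ge_inf; last by exists y.
    by exists (dot u y) => _ [z Kz <-]; apply: hy; rewrite inE.
  - apply: lb_le_inf; first by exists (dot u y), y.
    by move=> _ [z Kz <-]; apply: hy; rewrite inE.
split=> // x' y' Kx' Ky'; apply: lerB; first by apply: hx; rewrite inE.
by apply: hy; rewrite inE.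
Qed.

Lemma directional_width_ge0 u K : convex_body K -> 0 <= directional_width u K.
Proof.
move=> /(directional_width_attained u)[x [y [Kx _ _ h]]].
by rewrite -(subrr (dot u x)); exact: h.
Qed.

Lemma has_lbound_widths K : convex_body K ->
  has_lbound [set directional_width (map_mx intr u) K
      | u in [set u : 'rV[int]_d | u != 0]].
Proof. by move=> bK; exists 0 => _ [u _ <-]; exact: directional_width_ge0. Qed.

Lemma lattice_width_le (u : 'rV[int]_d) K : convex_body K -> u != 0 ->
  lattice_width K <= directional_width (map_mx intr u) K.
Proof.
by move=> bK u0; apply: ge_inf; [exact: has_lbound_widths|exists u].
Qed.

(** For d > 0 the all-ones vector is a nonzero direction; in dimension 0 the infimum would run over
    the empty set and take a default value. *)
Lemma lattice_width_ge K c : (0 < d)%N ->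
  (forall u : 'rV[int]_d, u != 0 -> c <= directional_width (map_mx intr u) K) ->
  c <= lattice_width K.
Proof.
move=> d0 h; apply: lb_le_inf; last by move=> _ [u u0 <-]; exact: h.
pose u : 'rV[int]_d := const_mx 1.
exists (directional_width (map_mx intr u) K), u => //.
by apply/eqP => /rowP/(_ (Ordinal d0)); rewrite !mxE.
Qed.

Lemma lattice_width_ge0 K : (0 < d)%N -> convex_body K -> 0 <= lattice_width K.
Proof.
by move=> d0 bK; apply: lattice_width_ge => // u _; exact: directional_width_ge0.
Qed.

Lemma convex_body_homothet a p K : convex_body K -> convex_body (homothet a p K).
Proof.
move=> [[x Kx] cK vK]; split.
- by exists (a *: x + p), x.
- apply: continuous_compact => //; apply: continuous_subspaceT => z.
  by apply: continuousD; [exact: scaler_continuous|exact: cst_continuous].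
- apply: convex_combP => _ _ t [y Ky <-] [z Kz <-] t01.
  exists (t *: y + (1 - t) *: z); first exact: convex_comb.
  by apply/rowP => i; rewrite !mxE; ring.
Qed.

Lemma directional_width_homothet u a p K : convex_body K -> 0 <= a ->
  directional_width u (homothet a p K) = a * directional_width u K.
Proof.
move=> bK a0.
have [x [y [Kx Ky -> hK]]] := directional_width_attained u bK.
have [x' [y' [[x1 Kx1 ex] [y1 Ky1 ey] e h]]] :=
  directional_width_attained u (convex_body_homothet a p bK).
apply/eqP; rewrite eq_le; apply/andP; split.
  rewrite e -ex -ey !dotDr !dotZr [leLHS](_ : _ = a * (dot u x1 - dot u y1)); last by ring.
  by rewrite ler_wpM2l//; exact: hK.
have := h _ _ (imageP _ Kx) (imageP _ Ky).
by rewrite !dotDr !dotZr => hxy; lra.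
Qed.

Lemma lattice_width_homothet a p K : (0 < d)%N -> convex_body K -> 0 < a ->
  lattice_width (homothet a p K) = a * lattice_width K.
Proof.
move=> d0 bK a0; apply/eqP; rewrite eq_le; apply/andP; split.
  rewrite mulrC -ler_pdivrMr//; apply: lattice_width_ge => // u u0.
  rewrite ler_pdivrMr// mulrC -(directional_width_homothet _ p bK (ltW a0)).
  by apply: lattice_width_le => //; exact: convex_body_homothet.
apply: lattice_width_ge => // u u0; rewrite (directional_width_homothet _ p bK (ltW a0)).
by rewrite ler_pM2l//; exact: lattice_width_le.
Qed.

Lemma interior_cubeP K x : K° x <-> exists2 r, 0 < r & cube x r `<=` K.
Proof.
split=> [/nbhs_ballP[r /= r0 hr]|[r r0 hr]].
  (* Balls are open and cubes closed, hence the halved radius. *)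
  exists (r / 2%:R); first by rewrite divr_gt0.
  move=> y hy; apply: hr; split=> // i j; rewrite (ord1 i) /ball /= distrC.
  by apply: le_lt_trans (hy j) _; lra.
apply/nbhs_ballP; exists r => //= y [_ hy]; apply: hr => i.
by have := hy 0 i; rewrite /ball /= distrC => /ltW.
Qed.

End Width.

(** * Volumes and lattice points *)

Lemma counting_le_size (R : realType) (T : choiceType) (A : set T) (s : seq T)
    (k : nat) :
  A `<=` [set` s] -> (size s <= k)%N -> (counting A <= k%:R%:E :> \bar R)%E.
Proof.
move=> As sk; have fA : finite_set A by apply: sub_finite_set As (finite_seq s).
rewrite /counting asboolT// lee_fin ler_nat (leq_trans _ sk)//.
apply: uniq_leq_size => [|x]; first exact: finmap.fset_uniq.
by rewrite in_fset_set// inE => /As.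
Qed.

Lemma counting_le_seq (R : realType) (T : choiceType) (A : set T) (k : nat) :
  (counting A <= k%:R%:E :> \bar R)%E ->
  exists2 s : seq T, A = [set` s] & (size s <= k)%N.
Proof.
rewrite /counting; case: ifPn => [/asboolP fA|//]; rewrite lee_fin ler_nat => Ak.
by exists (finmap.enum_fset (fset_set A)) => //; rewrite [LHS](esym (fset_setK fA)).
Qed.

Section Volume.
Context {R : realType} {d : nat}.
Implicit Types (A : set 'rV[R]_d) (s : seq ('rV[R]_d * 'rV[R]_d)).

Lemma box_volume_ge0 (a b : 'rV[R]_d) :
  (forall i, a 0 i <= b 0 i) -> 0 <= box_volume a b.
Proof. by move=> ab; apply: prodr_ge0 => i _; rewrite subr_ge0. Qed.

(** A finite cover is padded to a sequence by the box from 0 to 0, whose volume vanishes since d >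
    0; for d = 0 the empty product would be 1. *)
Lemma volume_le_seq A s : (0 < d)%N ->
  (forall ab, ab \in s -> forall i, ab.1 0 i <= ab.2 0 i) ->
  (forall x, A x -> exists2 ab, ab \in s & box ab.1 ab.2 x) ->
  (volume A <= (\sum_(ab <- s) box_volume ab.1 ab.2)%:E)%E.
Proof.
move=> d0 ss As; apply: ereal_inf_lbound.
exists (fun n => nth (0, 0) s n).
  split=> [n i|x /As[ab /(nthP (0, 0))[n ns <-] xab]]; last by exists n.
  have [ns|ns] := ltnP n (size s); first by apply: ss; rewrite mem_nth.
  by rewrite nth_default.
rewrite (nneseries_split 0 (size s)) => [|n _]; last first.
  rewrite lee_fin box_volume_ge0// => i.
  have [ns|ns] := ltnP n (size s); first by apply: ss; rewrite mem_nth.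
  by rewrite nth_default.
rewrite add0n [X in (_ + X)%E]eseries0 ?adde0.
  by rewrite sumEFin (big_nth (0, 0)).
move=> n ns _; rewrite nth_default// /box_volume (bigD1 (Ordinal d0))//=.
by rewrite subrr mul0r.
Qed.

Lemma volume_homothet (a v : R) (p : 'rV[R]_d) A : 0 < a ->
  (volume A <= v%:E)%E -> (volume (homothet a p A) <= (a ^+ d * v)%:E)%E.
Proof.
move=> a0 Av; apply/lee_addgt0Pr => e e0.
have ad : 0 < a ^+ d by rewrite exprn_gt0.
have /ereal_inf_lt[T [ab [abs Aab] <-{T}] Tv] : (volume A < (v + e / a ^+ d)%:E)%E.
  by apply: le_lt_trans Av _; rewrite lte_fin ltrDl divr_gt0.
apply: (@le_trans _ _ ((a ^+ d)%:E * (v + e / a ^+ d)%:E)%E); last first.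
  by rewrite -EFinM -EFinD lee_fin mulrDr mulrCA divff ?mulr1// gt_eqF.
apply: (@le_trans _ _ ((a ^+ d)%:E *
    (\sum_(0 <= n <oo) (box_volume (ab n).1 (ab n).2)%:E))%E); last first.
  by rewrite lee_pmul2l// ?lte_fin// ltW.
apply: ereal_inf_lbound.
exists (fun n => (a *: (ab n).1 + p, a *: (ab n).2 + p)); first split.
- by move=> n i; rewrite !mxE lerD2r ler_pM2l.
- move=> _ [x /Aab [n _ xn] <-]; exists n => //= i.
  by rewrite !mxE !lerD2r !ler_pM2l//; exact: xn.
rewrite -nneseriesZl => [|n _]; last by rewrite lee_fin box_volume_ge0.
apply: eq_eseriesr => n _; rewrite -EFinM; congr EFin.
rewrite /box_volume -[d in a ^+ d]card_ord -prodr_const -big_split.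
by apply: eq_bigr => i _; rewrite !mxE /=; ring.
Qed.

(** The enlarged total volume is a polynomial in [e], hence continuous at 0. *)
Lemma sum_box_enlarge s (c : R) :
  \sum_(ab <- s) box_volume ab.1 ab.2 < c ->
  exists2 r, 0 < r & forall e, 0 <= e <= r ->
    \sum_(ab <- s) \prod_(i < d) (ab.2 0 i - ab.1 0 i + e) < c.
Proof.
pose P : {poly R} := \sum_(ab <- s) \prod_(i < d) ((ab.2 0 i - ab.1 0 i)%:P + 'X).
have PE e : P.[e] = \sum_(ab <- s) \prod_(i < d) (ab.2 0 i - ab.1 0 i + e).
  rewrite horner_sum; apply: eq_bigr => ab _; rewrite horner_prod.
  by apply: eq_bigr => i _; rewrite hornerD hornerC hornerX.
have -> : \sum_(ab <- s) box_volume ab.1 ab.2 = P.[0].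
  by rewrite PE; apply: eq_bigr => ab _; apply: eq_bigr => i _; rewrite addr0.
move=> Pc; have /nbhs_ballP[r /= r0 hr] : nbhs (0 : R) [set e | P.[e] < c].
  exact: (cvgr_lt P.[0] (continuous_horner (x := 0))).
exists (r / 2%:R); first by rewrite divr_gt0.
move=> e e0; rewrite -PE; apply: hr; rewrite /ball /= sub0r normrN ger0_norm; lra.
Qed.

(** If [t] < [c] is the total volume of a countable cover, enlarging the n-th box at a cost below (c
    - t)/2^(n+2) makes the interiors an open cover, and the total cost stays below (c - t)/2.
    Compactness then leaves finitely many boxes. *)
Lemma finite_box_cover A (c : R) : compact A -> (volume A < c%:E)%E ->
  exists s, [/\ forall ab, ab \in s -> forall i, ab.1 0 i <= ab.2 0 i,
    forall x, A x -> exists2 ab, ab \in s & box ab.1 ab.2 x &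
    \sum_(ab <- s) box_volume ab.1 ab.2 < c].
Proof.
move=> cA /ereal_inf_lt[T [ab [abs Aab] <-{T}]].
set T := (\sum_(0 <= n <oo) _)%E => Tc.
have vol0 n : (0 <= (box_volume (ab n).1 (ab n).2)%:E :> \bar R)%E.
  by rewrite lee_fin box_volume_ge0.
have T0 : (0 <= T)%E by apply: nneseries_ge0 => n _ _.
have TE : T = (fine T)%:E by rewrite fineK// ge0_fin_numE// (lt_trans Tc)// ltry.
rewrite TE lte_fin in Tc; set t := fine T in TE Tc.
pose e n : R := (c - t) / 2%:R / 2%:R ^+ n.+1.
have e0 n : 0 < e n by rewrite !divr_gt0 ?subr_gt0// exprn_gt0.
have /choice[r hr] n : exists r : R, 0 < r /\
    \prod_(i < d) ((ab n).2 0 i - (ab n).1 0 i + r) <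
      box_volume (ab n).1 (ab n).2 + e n.
  have [|r r0 hr] := @sum_box_enlarge [:: ab n]
      (box_volume (ab n).1 (ab n).2 + e n).
    by rewrite big_seq1 ltrDl.
  by exists r; split=> //; have := hr r; rewrite big_seq1; apply; rewrite lexx ltW.
pose ab' n := ((ab n).1 - const_mx (r n / 2%:R), (ab n).2 + const_mx (r n / 2%:R)).
have := cA; rewrite compact_cover.
move=> /(_ nat setT (fun n => (box (ab' n).1 (ab' n).2)°))[].
- by move=> n _; exact: open_interior.
- move=> x /Aab[n _ xn]; exists n => //; apply/interior_cubeP.
  exists (r n / 2%:R) => [|y yx i]; first by rewrite divr_gt0//; case: (hr n).
  have := yx i; have := xn i; rewrite !mxE ler_norml => *.
  by apply/andP; split; lra.
(* A whole initial segment of indices is kept instead of [D], so that the sum compares with a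
   partial sum of the series. *)
move=> D _ AD; pose N := (\max_(i <- finmap.enum_fset D) i).+1.
exists [seq ab' n | n <- iota 0 N]; split.
- move=> _ /mapP[n _ ->] i; rewrite !mxE.
  by have := abs n i; have [r0 _] := hr n; lra.
- move=> x /AD[n nD /interior_subset xn]; exists (ab' n) => //.
  apply: map_f; rewrite mem_iota /= add0n ltnS.
  by apply: (@leq_bigmax_seq _ (finmap.enum_fset D) xpredT id n).
rewrite big_map.
have geo m : \sum_(n <- iota 0 m) e n = (c - t) / 2%:R * (1 - (2%:R ^+ m)^-1).
  elim: m => [|m IHm]; first by rewrite big_nil expr0 invr1 subrr mulr0.
  rewrite -addn1 iotaD big_cat IHm /= big_seq1 add0n /e addn1 exprS.
  by field; rewrite expf_neq0// pnatr_eq0.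
have tN : \sum_(n <- iota 0 N) box_volume (ab n).1 (ab n).2 <= t.
  rewrite -lee_fin -TE -sumEFin.
  have := @nneseries_lim_ge R _ xpredT 0 N (fun n _ _ => vol0 n).
  by rewrite /index_iota subn0.
apply: (@le_lt_trans _ _ (\sum_(n <- iota 0 N)
    (box_volume (ab n).1 (ab n).2 + e n))).
  apply: ler_sum => n _; apply: ltW; apply: le_lt_trans (proj2 (hr n)).
  rewrite le_eqVlt; apply/orP; left; apply/eqP; apply: eq_bigr => i _.
  by rewrite !mxE; field.
rewrite big_split [X in _ + X < _]geo.
have : 0 < (2%:R ^+ N)^-1 :> R by rewrite invr_gt0 exprn_gt0.
set q := (2%:R ^+ N)^-1 => q0.
have : (c - t) / 2%:R * (1 - q) <= (c - t) / 2%:R.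
  by rewrite ler_piMr//; lra.
lra.
Qed.

End Volume.

(** * Averaging lattice points over translates *)

Lemma pigeonhole_count (T : Type) (I : finType) (c : T -> I) (s : seq T) (k : nat) :
  (size s < k.+1 * #|I|)%N -> exists t, (count (fun x => c x == t) s <= k)%N.
Proof.
move=> sk; apply/existsP; apply: contraLR sk => /existsPn h; rewrite -leqNgt.
have -> : size s = (\sum_(t : I) count (fun x => c x == t) s)%N.
  elim: s {h} => [|x s IH]; first by rewrite big1.
  rewrite /= big_split /= -IH (bigD1 (c x))//= eqxx big1 ?addn0// => t.
  by rewrite eq_sym => /negPf->.
rewrite mulnC -sum_nat_const; apply: leq_sum => t _.
by rewrite ltnNge; exact: h.
Qed.

(** An interval of length L contains at most ML + 1 = M(L + 1/M) points of (1/M)Z. The bound is thus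
    M^d times the volume of an enlarged box, the form that [sum_box_enlarge] controls. *)
Lemma box_grid_points (R : realType) (d M : nat) (a b : 'rV[R]_d) :
  (0 < M)%N -> (forall i, a 0 i <= b 0 i) ->
  exists s : seq 'rV[int]_d,
    (forall m, box a b (M%:R^-1 *: map_mx intr m) -> m \in s) /\
    (size s)%:R <= M%:R ^+ d * \prod_(i < d) (b 0 i - a 0 i + M%:R^-1).
Proof.
move=> M0 ab; have M0' : 0 < M%:R :> R by rewrite ltr0n.
pose c i := Num.truncn (M%:R * (b 0 i - a 0 i)).
pose lo i := Num.ceil (M%:R * a 0 i).
have c0 i : 0 <= M%:R * (b 0 i - a 0 i) by rewrite mulr_ge0 ?subr_ge0 // ltW.
pose pt (f : {dffun forall i : 'I_d, 'I_(c i).+1}) : 'rV[int]_d :=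
  \row_i (lo i + (f i : nat)%:Z).
exists [seq pt f | f : {dffun forall i : 'I_d, 'I_(c i).+1}]; split.
  move=> m hm; apply/mapP.
  exists (finfun (fun i => inord (absz (m 0 i - lo i)%R)) :
     {dffun forall i : 'I_d, 'I_(c i).+1}); first by rewrite mem_enum.
  apply/rowP => i; rewrite !mxE ffunE.
  have := hm i; rewrite !mxE mulrC ler_pdivlMr// ler_pdivrMr// => /andP[h1 h2].
  have lom : lo i <= m 0 i by rewrite ceil_le_int mulrC.
  have E : (absz (m 0 i - lo i)%R)%:Z = m 0 i - lo i by rewrite gez0_abs ?subr_ge0.
  rewrite inordK; first by rewrite E addrC subrK.
  rewrite ltnS -(ler_nat R); have/andP[_ c1] := truncn_itv (c0 i).
  have : (absz (m 0 i - lo i)%R)%:R < (c i).+1%:R :> R.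
    apply: le_lt_trans c1; rewrite -[X in X <= _]/((absz (m 0 i - lo i)%R)%:Z%:~R).
    rewrite E intrB mulrBr.
    have := ceil_ge (M%:R * a 0 i); rewrite -/(lo i); lra.
  by rewrite ltr_nat ler_nat ltnS.
have -> : (size [seq pt f | f : {dffun forall i : 'I_d, 'I_(c i).+1}] =
    \prod_(i < d) (c i).+1)%N.
  rewrite size_map -cardE card_dep_ffun foldrE big_map big_enum.
  by apply: eq_bigr => i _; rewrite card_ord.
rewrite natr_prod.
have -> : M%:R ^+ d * \prod_(i < d) (b 0 i - a 0 i + M%:R^-1) =
    \prod_(i < d) (M%:R * (b 0 i - a 0 i + M%:R^-1)).
  by rewrite big_split prodr_const card_ord.
apply: ler_prod => i _; rewrite ler0n /= mulrDr divff ?gt_eqF//.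
by rewrite -natr1 lerD2r; have /andP[] := truncn_itv (c0 i).
Qed.

(** For large M, a finite box cover of K contains fewer than (k + 1) M^d points of (1/M)Z^d, counted
    box by box. These fall into M^d classes modulo Z^d, so some class has at most [k] of them. *)
Lemma translate_few_points (R : realType) (d k : nat) (K : set 'rV[R]_d) :
  compact K -> (volume K < k.+1%:R%:E)%E ->
  exists p : 'rV[R]_d, exists2 s : seq 'rV[int]_d, (size s <= k)%N &
    forall z, K (map_mx intr z + p) -> z \in s.
Proof.
move=> cK /(finite_box_cover cK)[s [ss Ks sk]].
have [r r0 hr] := sum_box_enlarge sk.
pose M := (Num.truncn r^-1).+1.
have M0 : 0 < M%:R :> R by rewrite ltr0n.
have Mr : M%:R^-1 <= r.
  rewrite -[r]invrK lef_pV2 ?posrE ?invr_gt0//; apply: ltW.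
  by have /andP[] := truncn_itv (ltW (etrans (invr_gt0 r) r0)).
have {hr sk}hM := hr M%:R^-1.
have [E hE sE] : exists2 E : seq 'rV[int]_d,
    forall ab m, ab \in s -> box ab.1 ab.2 (M%:R^-1 *: map_mx intr m) -> m \in E &
    (size E)%:R <= \sum_(ab <- s)
      (M%:R ^+ d * \prod_(i < d) (ab.2 0 i - ab.1 0 i + M%:R^-1)) :> R.
  elim: s ss {Ks hM} => [|ab s IH] ss; first by exists [::]; rewrite ?big_nil.
  have [|E hE sE] := IH; first by move=> x xs; apply: ss; rewrite inE xs orbT.
  have [|E' [hE' sE']] := @box_grid_points R d M ab.1 ab.2 isT.
    by apply: ss; rewrite mem_head.
  exists (E' ++ E); last by rewrite size_cat natrD big_cons lerD.
  move=> x m; rewrite inE mem_cat => /orP[/eqP->/hE'->//|xs xm].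
  by rewrite (hE _ _ xs xm) orbT.
pose c (m : 'rV[int]_d) : {ffun 'I_d -> 'I_M} :=
  [ffun i => inord (absz ((m 0%R i) %% M%:Z)%Z)].
have [|t ht] := @pigeonhole_count _ _ c E k.
  rewrite card_ffun !card_ord -(ltr_nat R) natrM natrX.
  apply: le_lt_trans sE _; rewrite -mulr_sumr mulrC ltr_pM2r ?exprn_gt0//.
  by apply: hM; rewrite invr_ge0 ltW.
(* The points z + t/M form the class of [t]; [z] is recovered from m = Mz + t by division by M. *)
exists (\row_i ((t i : nat)%:R / M%:R)).
exists [seq map_mx (fun x => (x %/ M%:Z)%Z) m | m <- E & c m == t].
  by rewrite size_map size_filter.
move=> z Kz; apply/mapP; pose m : 'rV[int]_d := \row_i (z 0 i * M%:Z + (t i : nat)%:Z).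
have tM i : 0 <= (t i : nat)%:Z < M%:Z by rewrite lez_nat ltz_nat /=.
exists m; last first.
  apply/rowP => i; rewrite !mxE divzMDl// divz_small ?addr0//.
rewrite mem_filter; apply/andP; split.
  apply/eqP/ffunP => i; rewrite ffunE mxE modzMDl modz_small//.
  by rewrite /= inord_val.
have [ab abs xab] := Ks _ Kz; apply: hE abs _.
rewrite (_ : M%:R^-1 *: _ = map_mx intr z + \row_i ((t i : nat)%:R / M%:R))//.
apply/rowP => i; rewrite !mxE intrD intrM -!pmulrn mulrC mulrDl mulfK//.
exact/lt0r_neq0.
Qed.

(** * Bounds on Flt *)

Section Flt.
Context {R : realType} {d : nat} (d0 : (0 < d)%N).
Implicit Types (K : set 'rV[R]_d) (k : nat).

Lemma lattice_width_le_Flt K k : convex_body K ->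
  (interior_lattice_points K <= k%:R%:E)%E -> ((lattice_width K)%:E <= Flt R d k)%E.
Proof. by move=> bK Kk; apply: ereal_sup_ubound; exists K. Qed.

Lemma interior_lattice_points_le K (s : seq 'rV[int]_d) k : (size s <= k)%N ->
  (forall z, K (map_mx intr z) -> z \in s) ->
  (interior_lattice_points K <= k%:R%:E)%E.
Proof.
move=> sk Ks; apply: (@counting_le_size _ _ _ [seq map_mx intr z | z <- s]).
  by move=> x [/interior_subset + [z _ zx]]; rewrite -zx => Kz; apply: map_f; exact: Ks.
by rewrite size_map.
Qed.

(** Without such a point, K would compete in the supremum defining Flt(d,0). *)
Lemma interior_lattice_point K : convex_body K ->
  (Flt R d 0 < (lattice_width K)%:E)%E -> exists z : 'rV[int]_d, K° (map_mx intr z).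
Proof.
move=> bK; apply: contraPP => Kz; apply/negP; rewrite -leNgt.
apply: lattice_width_le_Flt => //.
rewrite /interior_lattice_points (_ : _ `&` _ = set0); last first.
  by rewrite -subset0 => x [Kx [z _ zx]]; apply: Kz; exists z; rewrite zx.
exact: (@counting_le_size _ _ _ [::]).
Qed.

Lemma Flt0_le : (Flt R d 0 <= (100%:R ^+ d.+1)%:E)%E.
Proof.
apply: ge_ereal_sup => _ [K [bK K0] <-]; rewrite lee_fin leNgt; apply/negP => wK.
have [K_nonempty _ cK] := bK.
have [|u u0|z [r r0 zr]] := @flatness R d K K_nonempty cK.
- move=> u; exists (directional_width u K) => x y Kx Ky.
  by have [_ [_ [_ _ _]]] := directional_width_attained u bK; exact.
- have [x [y [Kx Ky e _]]] := directional_width_attained (map_mx intr u) bK.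
  exists x, y; split=> //; rewrite -e; apply: le_trans (ltW wK) _.
  exact: lattice_width_le.
have [s sE] := counting_le_seq K0; rewrite leqn0 => /nilP s0.
have : (K° `&` @lattice R d) (map_mx intr z).
  by split; [apply/interior_cubeP; exists r|exists z].
by rewrite sE s0 /=.
Qed.

(** A suitable translate, written as a homothet of ratio 1, has at most [k] lattice points and the
    same width. *)
Lemma lattice_width_le_Flt_volume K k : convex_body K ->
  (volume K < k.+1%:R%:E)%E -> ((lattice_width K)%:E <= Flt R d k)%E.
Proof.
move=> bK vK; have [_ cK _] := bK.
have [p [s sk Ks]] := translate_few_points cK vK.
rewrite -[lattice_width K]mul1r -(lattice_width_homothet (- p))//.
apply: lattice_width_le_Flt; first exact: convex_body_homothet.
apply: (interior_lattice_points_le sk) => z [x Kx zE].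
by apply: Ks; rewrite -zE scale1r subrK.
Qed.

(* In homothet mu (p + (lam - mu) o) K, the summand (lam - mu) o keeps the lattice
   point found for each class of grid points p modulo Z^d away from the boundary
   of K, by a margin that absorbs the side of the grid cubes. *)
Lemma volume_shrink K k (lam mu : R) (o : 'rV[R]_d) :
  convex_set K -> K° o -> 0 < mu -> mu < lam -> lam <= 1 ->
  (forall p, exists z : 'rV[int]_d, homothet mu p K (map_mx intr z)) ->
  (interior_lattice_points K <= k%:R%:E)%E ->
  (volume (homothet (1 - lam) 0 K) <= k%:R%:E)%E.
Proof.
move=> cK /interior_cubeP[r r0 oK] mu0 mulam lam1 muK /counting_le_seq[s sE sk].
pose N := (Num.truncn ((lam - mu) * r / 2%:R)^-1).+1.
have N0 : 0 < N%:R :> R by rewrite ltr0n.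
have lr0 : 0 < (lam - mu) * r / 2%:R by rewrite divr_gt0 ?mulr_gt0 ?subr_gt0.
have Nr : N%:R^-1 <= (lam - mu) * r / 2%:R.
  rewrite -[leRHS]invrK lef_pV2 ?posrE ?invr_gt0//; apply: ltW.
  have lr0' : 0 <= ((lam - mu) * r / 2%:R)^-1 by rewrite invr_ge0 ltW.
  by have /andP[] := truncn_itv lr0'.
pose g (t : {ffun 'I_d -> 'I_N}) : 'rV[R]_d := \row_i ((t i : nat)%:R / N%:R).
have /choice[z hz] t : exists z : 'rV[int]_d,
    homothet mu (g t + (lam - mu) *: o) K (map_mx intr z) by exact: muK.
(* For each class [t] and each interior lattice point [w] of K there is one cube of side 1/N: N^d
   |s| cubes of total volume |s| <= k. *)
pose corner (tw : {ffun 'I_d -> 'I_N} * 'rV[R]_d) := g tw.1 + tw.2 - map_mx intr (z tw.1).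
pose bx tw := (corner tw, corner tw + const_mx N%:R^-1).
have addc (v : 'rV[R]_d) i : (v + const_mx N%:R^-1) 0 i = v 0 i + N%:R^-1.
  by rewrite !mxE.
have subE (u v : 'rV[R]_d) i : (u - v) 0 i = u 0 i - v 0 i by rewrite !mxE.
pose S := [seq bx tw | tw <- [seq (t, w) | t <- enum {ffun 'I_d -> 'I_N}, w <- s]].
apply: (@le_trans _ _ (\sum_(ab <- S) box_volume ab.1 ab.2)%:E); last first.
  rewrite lee_fin /S big_map (eq_bigr (fun=> N%:R^-1 ^+ d)) => [|tw _]; last first.
    rewrite /box_volume (eq_bigr (fun=> N%:R^-1)) ?prodr_const ?card_ord// => i _.
    by rewrite addc addrC addKr.
  rewrite big_const_seq count_predT size_allpairs -cardE card_ffun !card_ord.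
  rewrite iter_addr_0 -[X in X <= _]mulr_natr natrM natrX mulrA -exprMn mulVf ?gt_eqF//.
  by rewrite expr1n mul1r ler_nat.
apply: volume_le_seq => //.
  by move=> _ /mapP[tw _ ->] i; rewrite addc lerDl invr_ge0 ltW.
move=> x0 [x Kx]; rewrite addr0 => xE.
(* Decomposition x0 = g t + y + e, with [y] integral and the entries of [e] between 0 and 1/N. *)
pose n i := Num.floor (N%:R * x0 0 i).
pose t : {ffun 'I_d -> 'I_N} := [ffun i => inord (absz (n i %% N%:Z)%Z)].
pose y : 'rV[int]_d := \row_i (n i %/ N%:Z)%Z.
have tE i : ((t i : nat)%:Z = (n i %% N%:Z)%Z).
  rewrite ffunE inordK; first by rewrite gez0_abs ?modz_ge0.
  by rewrite -ltz_nat gez0_abs ?modz_ge0// ltz_pmod.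
pose e := x0 - (g t + map_mx intr y).
have eN i : 0 <= e 0 i <= N%:R^-1.
  have -> : e 0 i = (N%:R * x0 0 i - (n i)%:~R) / N%:R.
    rewrite !mxE {2}(divz_eq (n i) N%:Z) -tE intrD intrM -!pmulrn.
    by rewrite mulrBl mulrDl mulfK ?lt0r_neq0// mulrAC divff ?lt0r_neq0// mul1r;
      congr (_ - _); rewrite addrC.
  have h1 : (n i)%:~R <= N%:R * x0 0 i by exact: floor_le_tmp.
  have h2 : N%:R * x0 0 i < (n i)%:~R + 1 by rewrite -[1]/1%:~R -intrD floorD1_gt.
  apply/andP; split; first by rewrite divr_ge0 ?subr_ge0// ltW.
  by rewrite -[leRHS]mul1r ler_pM2r ?invr_gt0//; lra.
have [c Kc cE] := hz t.
have KzI : K° (map_mx intr (z t + y)).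
  apply/interior_cubeP; exists ((lam - mu) * r / 2%:R) => // v hv.
  have lm0 : 0 < lam - mu by rewrite subr_gt0.
  have lam0 : 0 < lam by lra.
  (* With this [q], v = (1 - lam) x + mu c + (lam - mu) q, a convex combination. The distance from
     [q] to [o] is at most [r], because [v] and [e] each contribute at most (lam - mu) r/2 before
     division by lam - mu. *)
  pose q := o + (lam - mu)^-1 *: (v - map_mx intr (z t + y) - e).
  have qE (u w : 'rV[R]_d) a i : (u + a *: w) 0 i - u 0 i = a * w 0 i.
    by rewrite !mxE addrC addKr.
  have Kq : K q.
    apply: oK => i; rewrite qE normrM gtr0_norm ?invr_gt0//.
    rewrite ler_pdivrMl//.
    rewrite subE subE; have := hv i; have := eN i; rewrite !ler_norml.
    move: (e 0 i) (v 0 i - _) => u w /andP[? ?] /andP[? ?].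
    by apply/andP; split; lra.
  have -> : v = (1 - lam) *: x + (1 - (1 - lam)) *:
      ((mu / lam) *: c + (1 - mu / lam) *: q).
    have vE : v = map_mx intr (z t) + map_mx intr y + e + (lam - mu) *: (q - o).
      rewrite /q [_ - o]addrC addKr scalerA divff ?gt_eqF// scale1r.
      by apply/rowP => i; rewrite !mxE intrD; ring.
    rewrite [LHS]vE -cE /e -xE; apply/rowP => i; rewrite !mxE; field.
    by rewrite !lt0r_neq0.
  apply: convex_comb => //; last by lra.
  apply: convex_comb => //; rewrite divr_ge0 ?ler_pdivrMr ?mul1r//; lra.
exists (bx (t, map_mx intr (z t + y))).
  apply: map_f; apply: allpairs_f; first by rewrite mem_enum.
  have : (K° `&` @lattice R d) (map_mx intr (z t + y)) by split=> //; exists (z t + y).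
  by rewrite sE.
have cornerE : corner (t, map_mx intr (z t + y)) = g t + map_mx intr y.
  by rewrite /corner /= map_mxD; apply/rowP => i; rewrite !mxE; ring.
move=> i; rewrite /bx /= cornerE; have := eN i.
rewrite addc.
rewrite [e 0 i]subE.
by move: (_ 0 i) => q /andP[h1 h2]; apply/andP; split; lra.
Qed.

End Flt.

(** * Comparison of Flt(d,k) with Flt(d,oo) *)

Section Bounds.
Context {R : realType} {d : nat} (d0 : (0 < d)%N).
Implicit Types (K : set 'rV[R]_d) (k : nat).

Lemma convex_body_point (x : 'rV[R]_d) : convex_body [set x].
Proof.
split; [by exists x|exact: compact_set1|].
by apply: convex_combP => _ _ t -> -> _ /=; rewrite -scalerDl addrC subrK scale1r.
Qed.

Lemma volume_point (x : 'rV[R]_d) : (volume [set x] <= 0)%E.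
Proof.
have -> : (0 = (\sum_(ab <- [:: (x, x)]) box_volume ab.1 ab.2)%:E :> \bar R)%E.
  by rewrite big_seq1 /box_volume (bigD1 (Ordinal d0))//= subrr mul0r.
apply: volume_le_seq => // [ab|_ ->]; first by rewrite inE => /eqP-> i /=.
by exists (x, x); rewrite ?mem_head// => i /=; rewrite lexx.
Qed.

(** A single point has volume 0, so its nonnegative width bounds the supremum from below. *)
Lemma Flt_ge0 k : (0 <= Flt R d k)%E.
Proof.
apply: (@le_trans _ _ (lattice_width [set (0 : 'rV[R]_d)])%:E).
  by rewrite lee_fin; apply: lattice_width_ge0 => //; exact: convex_body_point.
apply: lattice_width_le_Flt_volume => //; first exact: convex_body_point.
by apply: le_lt_trans (volume_point _) _; rewrite lte_fin.
Qed.

Lemma Flt_infty_ge0 : (0 <= Flt_infty R d)%E.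
Proof.
apply: (@le_trans _ _ (lattice_width [set (0 : 'rV[R]_d)])%:E).
  by rewrite lee_fin; apply: lattice_width_ge0 => //; exact: convex_body_point.
apply: ereal_sup_ubound; exists [set (0 : 'rV[R]_d)] => //.
split; first exact: convex_body_point.
by apply: le_trans (volume_point _) _; rewrite lee_fin.
Qed.

(** Scaling a body of volume at most 1 by [a] gives volume below k + 1. Keeping [a] free serves both
    a = k^(1/d) and the finiteness of Flt(d,oo). *)
Lemma Flt_infty_le_Flt (a : R) k : 0 < a -> a ^+ d < k.+1%:R ->
  (Flt_infty R d <= a^-1%:E * Flt R d k)%E.
Proof.
move=> a0 ak; apply: ge_ereal_sup => _ [K [bK vK] <-].
have h : ((lattice_width (homothet a 0 K))%:E <= Flt R d k)%E.
  apply: lattice_width_le_Flt_volume => //; first exact: convex_body_homothet.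
  apply: le_lt_trans (volume_homothet 0 a0 vK) _.
  by rewrite mulr1 lte_fin.
rewrite -[X in (X <= _)%E](_ : a^-1%:E * (lattice_width (homothet a 0 K))%:E = _)%E.
  by rewrite lee_pmul2l// lte_fin invr_gt0.
by rewrite lattice_width_homothet// -EFinM mulrA mulVf ?gt_eqF// mul1r.
Qed.

Lemma Flt_le (F0 Fi s : R) k : Flt R d 0 = F0%:E -> Flt_infty R d = Fi%:E ->
  0 < s -> s ^+ d = k%:R -> (Flt R d k <= (F0 + s * Fi)%:E)%E.
Proof.
move=> hF0 hFi s0 sk; apply: ge_ereal_sup => _ [K [bK Kk] <-].
have F0_ge0 : 0 <= F0 by rewrite -lee_fin -hF0 Flt_ge0.
have Fi_ge0 : 0 <= s * Fi.
  by rewrite mulr_ge0 ?(ltW s0)// -lee_fin -hFi Flt_infty_ge0.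
set w := lattice_width K; rewrite lee_fin; apply/ler_addgt0Pr => e e0.
have [we|we] := lerP w (F0 + e); first by lra.
have w0 : 0 < w by lra.
(* Since mu w = F0 + e/2 exceeds Flt(d,0), every translate of mu K contains a lattice point; lam -
   mu is the room that [volume_shrink] requires. Then (1 - lam) w <= s Fi reads w <= F0 + e + s
   Fi. *)
pose lam := (F0 + e) / w; pose mu := (F0 + e / 2%:R) / w.
have mu0 : 0 < mu by rewrite divr_gt0//; lra.
have mulam : mu < lam by rewrite ltr_pM2r ?invr_gt0//; lra.
have lam1 : lam < 1 by rewrite ltr_pdivrMr// mul1r.
have lam1' : 0 < 1 - lam by rewrite subr_gt0.
have [|o Ko] := interior_lattice_point bK.
  by rewrite hF0 lte_fin -/w; lra.
have muK p : exists z : 'rV[int]_d, homothet mu p K (map_mx intr z).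
  have [|z /interior_subset hz] :=
      interior_lattice_point (convex_body_homothet mu p bK); last by exists z.
  by rewrite hF0 lte_fin lattice_width_homothet// divfK ?gt_eqF//; lra.
have [_ _ cK] := bK.
have vK := volume_shrink d0 cK Ko mu0 mulam (ltW lam1) muK Kk.
have si0 : 0 < s^-1 by rewrite invr_gt0.
have vK' := volume_homothet 0 si0 vK.
have bK1 := convex_body_homothet (1 - lam) 0 bK.
have : ((lattice_width (homothet s^-1 0 (homothet (1 - lam) 0 K)))%:E <= Fi%:E)%E.
  rewrite -hFi; apply: ereal_sup_ubound.
  exists (homothet s^-1 0 (homothet (1 - lam) 0 K)) => //; split.
    exact: convex_body_homothet.
  by move: vK'; rewrite -sk -exprMn mulVf ?gt_eqF// expr1n.
rewrite lee_fin !lattice_width_homothet// ler_pdivrMl// -/w mulrBl mul1r.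
rewrite divfK ?gt_eqF//; lra.
Qed.

Lemma fin_num_Flt0 : Flt R d 0 \is a fin_num.
Proof. by rewrite ge0_fin_numE ?Flt_ge0// (le_lt_trans Flt0_le)// ltry. Qed.

Lemma fin_num_Flt_infty : Flt_infty R d \is a fin_num.
Proof.
rewrite ge0_fin_numE ?Flt_infty_ge0//.
(* With k = 0, any ratio a < 1 bounds Flt(d,oo) by Flt(d,0)/a. *)
apply: le_lt_trans (@Flt_infty_le_Flt (1 / 2%:R) 0 _ _) _.
- by rewrite divr_gt0.
- by rewrite exprn_ilt1 ?gtn_eqF//; lra.
- by rewrite -(fineK fin_num_Flt0) -EFinM ltry.
Qed.

(** As s^d = k < k + 1, [Flt_infty_le_Flt] applies with a = s and makes the difference nonnegative;
    [Flt_le] bounds it from above. *)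
Lemma Flt_bounds (s : R) k : 0 < s -> s ^+ d = k%:R ->
  exists2 F : R, Flt R d k = F%:E &
    `|F / s - fine (Flt_infty R d)| <= fine (Flt R d 0) / s.
Proof.
move=> s0 sk.
have hF0 := esym (fineK fin_num_Flt0); have hFi := esym (fineK fin_num_Flt_infty).
set F0 := fine (Flt R d 0) in hF0 *; set Fi := fine (Flt_infty R d) in hFi *.
have up := Flt_le hF0 hFi s0 sk.
have hF : Flt R d k = (fine (Flt R d k))%:E.
  by rewrite fineK// ge0_fin_numE ?Flt_ge0// (le_lt_trans up)// ltry.
exists (fine (Flt R d k)) => //; move: hF up; set F := fine _ => hF.
have := @Flt_infty_le_Flt s k s0; rewrite sk ltr_nat ltnSn => /(_ isT).
rewrite hF hFi -EFinM !lee_fin ler_pdivlMl// => lo up.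
have F0_ge0 : 0 <= F0 by rewrite -lee_fin -hF0 Flt_ge0.
have -> : F / s - Fi = (F - s * Fi) / s by field; rewrite gt_eqF.
by rewrite normrM (gtr0_norm (x := s^-1)) ?invr_gt0// ler_pM2r ?invr_gt0// ger0_norm; lra.
Qed.

End Bounds.

(** * Real d-th roots and passage to the limit *)

Lemma powR_rootK (R : realType) (d k : nat) : (0 < d)%N ->
  (k%:R `^ d%:R^-1) ^+ d = k%:R :> R.
Proof.
by move=> d0; rewrite -powR_mulrn ?powR_ge0// -powRrM mulVf ?pnatr_eq0 -?lt0n// powRr1.
Qed.

Theorem theorem2p3 (R : realType) (d : nat) (hd : (1 <= d)%N) :
  (forall k : nat, (1 <= k)%N ->
    (`| Flt R d k * ((k%:R `^ d%:R^-1)^-1)%R%:E - Flt_infty R d |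
       <= Flt R d 0 * ((k%:R `^ d%:R^-1)^-1)%R%:E)%E) /\
  (fun k : nat => ((k%:R `^ (- d%:R^-1))%R%:E * Flt R d k)%E) @ \oo
    --> Flt_infty R d.
Proof.
have s0 k : (1 <= k)%N -> 0 < k%:R `^ d%:R^-1 :> R.
  by move=> k1; rewrite powR_gt0// ltr0n.
have hF0 := fineK (@fin_num_Flt0 R d hd).
have hFi := fineK (@fin_num_Flt_infty R d hd).
split=> [k k1|].
  have [F -> hF] := Flt_bounds hd (s0 k k1) (powR_rootK R k hd).
  by rewrite -hF0 -hFi -!EFinM -EFinB abse_EFin lee_fin.
rewrite -hFi; apply/fine_cvgP; split.
  near=> k; have k1 : (1 <= k)%N by near: k; exists 1%N.
  by have [F -> _] := Flt_bounds hd (s0 k k1) (powR_rootK R k hd).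
apply/cvgrPdist_le => e e0; near=> k.
have k1 : (1 <= k)%N by near: k; exists 1%N.
have [F hF hk] := Flt_bounds hd (s0 k k1) (powR_rootK R k hd).
rewrite /= hF -EFinM /= powRN mulrC distrC; apply: le_trans hk _.
rewrite ler_pdivrMr ?s0// -ler_pdivrMl// mulrC.
have F0_ge0 : 0 <= fine (Flt R d 0) by rewrite -lee_fin hF0 Flt_ge0.
(* Taking d-th powers turns Flt(d,0)/e <= k^(1/d) into (Flt(d,0)/e)^d <= k, which holds for large
   [k]. *)
rewrite -(@ler_pXn2r _ d)// ?nnegrE ?powR_ge0 ?(divr_ge0 F0_ge0 (ltW e0))//.
by rewrite powR_rootK//; near: k; exact: nbhs_infty_ger.
Unshelve. all: by end_near. Qed.
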